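(* A random variable $X$ being measurable with respect to $\mathcal F$ is not always sufficient to treat $X$ as deterministic in $\mathbb E[\mathbf f(X)\mid\mathcal F]$ (there is a joint kernel that is not plug-in consistent): let $Y\sim\mathcal N(0,1)$ be a standard normal random variable independent of a standard uniform random variable $U\sim\mathcal U(0,1)$, let $\mathbf f(x):=Y$ for all $x$ (a constant Gaussian random function) and let $\mathcal F:=\sigma(U)$. Since the conditional expectation is only well-defined up to null sets, for every deterministic $x$ $$\mathbb E[\mathbf f(x)\mid U]=\mathbb E[Y]\,\mathbf 1_{\{U\ne x\}}=:g(x)\quad\text{a.s.}$$ However, $$g(U)=0\ne\mathbb E[Y]=\mathbb E[\mathbf f(U)\mid U],$$ where the last equality holds almost surely. Thus $g$ is a valid formula for $\mathbb E[\mathbf f(x)\mid U]$ for all deterministic $x$, but it is not valid for the random $X=U$, even though $X$ is measurable with respect to $\mathcal F=\sigma(U)$. Similarly, one could construct $g$ to not be a measurable function, in which case $g(U)$ would not even be a valid random variable.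
   Context: $\mathcal N(m,s^2)$ is the normal distribution with mean $m$ and variance $s^2$; $\mathcal U(0,1)$ is the uniform distribution on $(0,1)$. The index $x$ ranges over $[0,1]$. For each $x$, $g(x)$ is a random variable, and $g(U)$ denotes $\omega\mapsto g(U(\omega))(\omega)$. A formula (joint kernel) for the conditional distribution of $\mathbf f(x)$ given $\mathcal F$, jointly measurable in $\omega$ and $x$ and valid for all deterministic $x$, is called plug-in consistent if it remains valid when $x$ is replaced by any $\mathcal F$-measurable random variable $X$.
   Formalization: For Y~N(0,1), E[Y]=0, so ''0≠E[Y]'' and the failure of g at X=U are false; the formal version takes Y~N(m,s²), requires m≠0 for these two claims, and proves everything else (including a joint kernel that is not plug-in consistent) for every m. *)

(* Defs.v *)
From HB Require Import structures.
From mathcomp Require Import all_boot all_order all_algebra.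
From mathcomp Require Import all_classical all_reals all_analysis.
Set Implicit Arguments.
Unset Strict Implicit.
Unset Printing Implicit Defensive.
Import Order.TTheory GRing.Theory Num.Theory.
Import numFieldNormedType.Exports.
Local Open Scope classical_set_scope.
Local Open Scope ring_scope.

(* A sub-sigma-algebra of T is given as a set system F : set (set T); the     *)
(* measurable space (T, F) is then [g_sigma_algebraType F].                   *)

(* [E[X | F] = Z a.s.]: Z is a version of the conditional expectation.        *)
Definition is_condexp d (T : measurableType d) (R : realType)
    (P : probability T R) (F : set (set T)) (X Z : T -> R) : Prop :=
  [/\ P.-integrable setT (EFin \o X),
      measurable_fun (setT : set (g_sigma_algebraType F)) Z,
      P.-integrable setT (EFin \o Z) &
      forall A : set T, F.-sigma.-measurable A ->
        (\int[P]_(w in A) (Z w)%:E = \int[P]_(w in A) (X w)%:E)%E].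

(* w |-> nu w is a version of the conditional law P(X \in . | F).             *)
Definition is_condlaw d (T : measurableType d) (R : realType)
    (P : probability T R) (F : set (set T)) (X : T -> R)
    (nu : T -> set R -> \bar R) : Prop :=
  forall B : set R, measurable B ->
    is_condexp P F (\1_(X @^-1` B)) (fun w => fine (nu w B)).

(* kappa is a joint kernel for the laws of f x given F, x in [0, 1].  Only    *)
(* the indices in [0, 1] matter: a kernel on (T, F) * [0, 1] extends to the   *)
(* whole of (T, F) * R along the retraction of R onto [0, 1].                 *)
Definition is_joint_kernel d (T : measurableType d) (R : realType)
    (P : probability T R) (F : set (set T)) (f : R -> T -> R)
    (kappa : R.-pker (g_sigma_algebraType F * R) ~> R) : Prop :=
  forall x : R, x \in `[0, 1] ->
    is_condlaw P F (f x) (fun w => kappa (w, x)).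

Definition plug_in_consistent d (T : measurableType d) (R : realType)
    (P : probability T R) (F : set (set T)) (f : R -> T -> R)
    (kappa : R.-pker (g_sigma_algebraType F * R) ~> R) : Prop :=
  forall X : T -> R,
    measurable_fun (setT : set (g_sigma_algebraType F)) X ->
    (forall w, X w \in `[0, 1]) ->
    is_condlaw P F (fun w => f (X w) w) (fun w => kappa (w, X w)).

Definition jointly_measurable d (T : measurableType d) (R : realType)
    (h : R -> T -> R) : Prop :=
  measurable_fun ((setT : set T) `*` (`[0, 1] : set R))
    (fun wx : T * R => h wx.2 wx.1).

(* Laws are compared on measurable sets only: a {measure set R -> \bar R} is  *)
(* a function on all sets, with no control on the non-measurable ones.        *)
Definition has_law d (T : measurableType d) (R : realType)
    (P : probability T R) (X : {RV P >-> R}) (mu : set R -> \bar R) : Prop :=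
  forall B : set R, measurable B -> distribution P X B = mu B.

Definition independent_rv d (T : measurableType d) (R : realType)
    (P : probability T R) (X Y : {RV P >-> R}) : Prop :=
  forall A B : set R, measurable A -> measurable B ->
    P (X @^-1` A `&` Y @^-1` B) = (P (X @^-1` A) * P (Y @^-1` B))%E.

(* Y ~ N(m, s^2) and U ~ U(0, 1) are independent; the parameter of            *)
(* [normal_prob] is the standard deviation.                                   *)
Definition normal_uniform_pair d (T : measurableType d) (R : realType)
    (P : probability T R) (m s : R) (Y U : {RV P >-> R}) : Prop :=
  [/\ has_law Y (normal_prob m s),
      has_law U (uniform_prob (@ltr01 R)) &
      independent_rv Y U].

Definition sigma_gen d (T : measurableType d) (R : realType)
    (P : probability T R) (U : {RV P >-> R}) : set (set T) :=
  g_sigma_algebra_preimage (U : T -> R).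

Definition const_field d (T : measurableType d) (R : realType)
    (P : probability T R) (Y : {RV P >-> R}) : R -> T -> R :=
  fun _ w => Y w.

Definition punctured_mean d (T : measurableType d) (R : realType)
    (P : probability T R) (Y U : {RV P >-> R}) : R -> T -> R :=
  fun x w => fine ('E_P[Y])%E * \1_[set w' | U w' <> x] w.

(* Main.v *)
Require Import Defs.
From HB Require Import structures.
From mathcomp Require Import all_boot all_order all_algebra.
From mathcomp Require Import all_classical all_reals all_analysis.
From mathcomp Require Import measurable_realfun ring lra.
Import Order.TTheory GRing.Theory Num.Theory.
Import numFieldNormedType.Exports.
Local Open Scope classical_set_scope.
Local Open Scope ring_scope.

(** Two random objects can agree at every deterministic index x, up to a null
    set that depends on x, and still differ at a random index: the union over
    x of the exceptional sets need not be null.  Here the exceptional set at x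
    is the event U = x, which is null because U has a density, while at the
    index X = U the event U = X is certain.

    Every formula below is therefore obtained in the same way, by [pinned]:
    keep the correct value c off the event U = x and take an arbitrary value
    a(x) on it.  Since c is correct by independence of Y and U
    ([integral_indep]), the result is a version of the conditional expectation
    given U for each x ([condexp_pinned]), but its value at X = U is a(U).
    - The value a = 0 gives the punctured mean g, which fails at X = U when m
      is not 0, and a = m + 1 gives a formula that fails there whatever m is:
      integrate over the whole space ([condexp_cst_neq]).
    - With the law of Y in the role of c and the Dirac mass at 0 in that of a,
      one gets a joint kernel with barycentre g.  At X = U it charges the
      point 0, which Y avoids almost surely
      ([pinned_kernel_not_condlaw]).
    - With a the indicator of a set that is not Borel, the composite with U
      is not measurable.

    What these arguments take from analysis is that N(m, s^2) is integrable
    with mean m ([integrable_normal_prob_id], [mean_normal_prob]) and that the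
    unit interval has a subset that is not Borel
    ([nonmeasurable_subset_unit_interval], the Vitali set).  Existence of the
    pair is witnessed by the coordinates of a product space. *)

(** * Translation invariance and the Vitali set *)

Lemma lebesgue_measureDr (R : realType) (q : R) (A : set R) : measurable A ->
  pushforward lebesgue_measure ((fun x => x + q) : _ -> measurableTypeR R) A =
  lebesgue_measure A.
Proof.
move=> mA; apply/esym/lebesgue_measure_unique => //=.
  exact: measurable_funD.
move=> mq _ [[a b]] _ <-; rewrite /pushforward.
rewrite (_ : _ @^-1` _ = `]a - q, b - q]%classic); last first.
  by apply/seteqP; split => x /=; rewrite !in_itv/= ltrBlDr lerBrDr.
rewrite !lebesgue_measure_itv/= !lte_fin ltrD2r.
by congr (if _ then _ else _); rewrite -!EFinB; congr EFin; ring.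
Qed.

(** Let V consist of one point of [0, 1] from each class of reals modulo the
    rationals.  If V were Borel, then its rational translates, which cover
    [0, 1], would force its measure to be positive, whereas the disjoint
    translates by 1/(n+1), which all lie in [0, 2], would force it to be
    zero. *)
Lemma nonmeasurable_subset_unit_interval (R : realType) :
  exists V : set R, V `<=` `[0, 1] /\ ~ measurable V.
Proof.
pose sim (x : R) : set R :=
  [set y | y \in `[0, 1] /\ exists q : rat, y = x + ratr q].
pose e (x : R) : R := xget 0 (sim x).
have simE (x y : R) (q : rat) : y = x + ratr q -> sim x = sim y.
  move=> ->{y}; apply/seteqP; split => z [z01 [p zE]]; split=> //.
    by exists (p - q); rewrite zE rmorphB/=; ring.
  by exists (q + p); rewrite zE rmorphD/=; ring.
have eP (x : R) : x \in `[0, 1] -> sim x (e x).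
  move=> x01; apply: (@xgetI _ 0 (sim x) x); split => //; exists 0.
  by rewrite rmorph0 addr0.
pose V : set R := e @` `[0, 1].
have V01 : V `<=` `[0, 1] by move=> _ [x /= x01 <-]; case: (eP x x01).
exists V; split => // mV.
have Vinj (u v : R) (q : rat) : V u -> V v -> v = u + ratr q -> u = v.
  move=> [x /= x01 <-] [y /= y01 <-].
  have [_ [p xE]] := eP x x01; have [_ [r yE]] := eP y y01 => xy.
  suff <- : e x = e y by [].
  have : sim x = sim y.
    apply: (@simE _ _ (p + q - r)); rewrite rmorphB rmorphD/=.
    move: xy; rewrite xE yE => xy.
    by apply: (addIr (ratr r)); rewrite xy; ring.
  by rewrite /e => ->.
(* [tr r] is the translate V - r *)
pose tr (r : R) : set R := (fun x => x + r) @^-1` V.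
have mtr r : measurable (tr r).
  rewrite /tr -[X in measurable X]setTI.
  by apply: measurable_funD.
have trE r : lebesgue_measure (tr r) = lebesgue_measure V.
  exact: lebesgue_measureDr.
have [V0|V0] := eqVneq (@lebesgue_measure R V) 0%E.
  (* a null V would make the unit interval null *)
  pose q n : rat := odflt 0 (unpickle n).
  have : (@lebesgue_measure R).-negligible (\bigcup_n tr (ratr (q n))).
    apply: negligible_bigcup => n; exists (tr (ratr (q n))).
    split; [exact: mtr| |by []].
    exact: etrans (trE _) V0.
  case=> N [mN N0 cN].
  suff : (@lebesgue_measure R `[0%R, 1%R] <= 0)%E.
    by rewrite lebesgue_measure_itv/= lte01 oppr0 adde0 lee_fin ler10.
  rewrite -N0; apply: le_measure; rewrite ?inE//.
  move=> x /= x01; apply: cN.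
  have [_ [p ep]] := eP x x01; exists (pickle p) => //.
  by rewrite /tr/= /q pickleK/= -ep; exists x.
(* a V of positive measure v would give the interval [0, 2] a measure of at
   least k v for every k *)
pose r (n : nat) : rat := - n.+1%:R^-1.
have trI : trivIset setT (fun n => tr (ratr (r n))).
  apply: ltn_trivIset => n2 n1 n12; rewrite -subset0 => x [/= h1 h2].
  have := Vinj _ _ (r n2 - r n1) h1 h2.
  have -> : x + ratr (r n2) = x + ratr (r n1) + ratr (r n2 - r n1) :> R.
    by rewrite rmorphB/=; ring.
  move=> /(_ erefl) /esym/eqP; rewrite -subr_eq0 addrAC subrr add0r.
  rewrite fmorph_eq0 subr_eq0 eqr_opp => /eqP/invr_inj/eqP.
  by rewrite eqr_nat eqSS => /eqP h; rewrite h ltnn in n12.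
have cover : \bigcup_i tr (ratr (r i)) `<=` (`[0, 2]%classic : set R).
  move=> x [i _ /V01]; have -> : ratr (r i) = - i.+1%:R^-1 :> R.
    by rewrite /r rmorphN/= fmorphV/= ratr_nat.
  rewrite /= !in_itv/=.
  have k0 : 0 <= (i.+1%:R^-1 : R) by rewrite invr_ge0.
  have k1 : (i.+1%:R^-1 : R) <= 1 by rewrite invf_le1// ler1n.
  move: (i.+1%:R^-1 : R) k0 k1 => k k0 k1 /andP[h0 h1].
  by apply/andP; split; lra.
have mU : measurable (\bigcup_i tr (ratr (r i))) by exact: bigcup_measurable.
have le2 : (@lebesgue_measure R (\bigcup_i tr (ratr (r i))) <= 2%:E)%E.
  rewrite (_ : 2%:E = @lebesgue_measure R `[0%R, 2%R]).
    by apply: le_measure; rewrite ?inE//; exact: cover.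
  by rewrite lebesgue_measure_itv/= lte_fin ltr0n/= oppr0 adde0.
rewrite measure_bigcup in le2; [|by move=> i _; exact: mtr|exact: trI].
have [v vE] : exists v : R, lebesgue_measure V = v%:E.
  exists (fine (lebesgue_measure V)); rewrite fineK// ge0_fin_numE//.
  apply: (@le_lt_trans _ _ (@lebesgue_measure R `[0%R, 1%R])).
    by apply: le_measure; rewrite ?inE.
  by rewrite lebesgue_measure_itv/= lte01 oppr0 adde0 ltry.
have v0 : 0 < v.
  by rewrite -lte_fin -vE lt0e V0 measure_ge0.
pose k := (Num.truncn (2 / v)).+1.
have := le_trans (@nneseries_lim_ge R _ _ 0%N k _) le2.
have /[swap] /[apply] : forall n, (0 <= n)%N -> n \in setT ->
    (0 <= @lebesgue_measure R (tr (ratr (r n))))%E by [].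
rewrite (eq_bigr (fun=> v%:E)); last by move=> i _; exact: etrans (trE _) vE.
rewrite big_mkcond/= (eq_bigr (fun=> v%:E)); last first.
  by move=> i _; rewrite in_setT.
rewrite sumEFin sumr_const_nat subn0 lee_fin -(mulr_natl v) leNgt.
move=> /negP; apply.
by rewrite -ltr_pdivrMr// truncnS_gt.
Qed.

(** * The mean of the normal distribution *)

(** The normal density is a Radon-Nikodym derivative of the normal
    distribution, hence equals almost everywhere the derivative for which the
    change of measure is known. *)
Lemma ge0_integral_normal_prob (R : realType) (m s : R) (f : R -> R) :
  measurable_fun setT f -> (forall x, 0 <= f x) ->
  (\int[normal_prob m s]_x (f x)%:E =
   \int[lebesgue_measure]_x (f x * normal_pdf m s x)%:E)%E.
Proof.
move=> mf f0; have dom := @normal_prob_dominates R m s.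
pose N : probability (measurableTypeR R) R := normal_prob m s.
have mpdf : measurable_fun setT (EFin \o normal_pdf m s).
  by apply/measurable_EFinP; exact: measurable_normal_pdf.
pose D := Radon_Nikodym_SigmaFinite.f N (@lebesgue_measure R).
have DE : ae_eq (@lebesgue_measure R) setT D (EFin \o normal_pdf m s).
  apply: integral_ae_eq => //.
    exact: Radon_Nikodym_SigmaFinite.f_integrable.
  by move=> E _ mE; rewrite -Radon_Nikodym_SigmaFinite.f_integral.
rewrite -(Radon_Nikodym_SigmaFinite.change_of_variables dom)//; last first.
  exact/measurable_EFinP.
apply: ae_eq_integral => //.
- apply: emeasurable_funM; first exact/measurable_EFinP.
  apply: measurable_int (Radon_Nikodym_SigmaFinite.f_integrable dom).
- apply/measurable_EFinP; apply: measurable_funM => //.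
  exact: measurable_normal_pdf.
- under [X in ae_eq _ _ _ X]eq_fun do rewrite EFinM.
  exact: ae_eqe_mul2l.
Qed.

(** Half of the Gaussian exponent absorbs the linear factor: with
    t = |x - m| / s one has t <= 1 + t^2 / 4 <= exp (t^2 / 4), and
    exp (- t^2 / 2 + t^2 / 4) is the profile of the normal density with
    variance 2 s^2.  The first moment is thus dominated by a total mass. *)
Lemma normal_pdf_widen (R : realType) (m s x : R) : 0 < s ->
  `|x - m| * normal_pdf m s x <=
  s * normal_peak s / normal_peak (Num.sqrt 2 * s) *
    normal_pdf m (Num.sqrt 2 * s) x.
Proof.
move=> s0; have s20 : Num.sqrt 2 * s != 0.
  by rewrite mulf_neq0 ?gt_eqF// sqrtr_gt0.
rewrite !normal_pdfE// ?gt_eqF//.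
rewrite [leRHS]mulrA divfK ?gt_eqF ?normal_peak_gt0// -/(normal_fun _ _ _).
rewrite mulrCA (mulrC s) -[leRHS]mulrA ler_pM2l ?normal_peak_gt0 ?gt_eqF//.
rewrite /normal_fun exprMn sqr_sqrtr//.
pose t := `|x - m| / s.
have -> : - (x - m) ^+ 2 / (s ^+ 2 *+ 2) = - (t ^+ 2 / 2).
  by rewrite /t exprMn real_normK ?num_real// -mulr_natr; field; rewrite gt_eqF.
have -> : - (x - m) ^+ 2 / (2 * s ^+ 2 *+ 2) = t ^+ 2 / 4 - t ^+ 2 / 2.
  by rewrite /t exprMn real_normK ?num_real// -mulr_natr; field; rewrite gt_eqF.
rewrite expRD mulrA ler_pM2r ?expR_gt0//.
rewrite -ler_pdivrMl// mulrC -/t.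
apply: le_trans (expR_ge1Dx _).
have := sqr_ge0 (t / 2 - 1); nra.
Qed.

Lemma integrable_normal_prob_id (R : realType) (m s : R) : 0 < s ->
  (normal_prob m s).-integrable setT EFin.
Proof.
move=> s0.
have -> : EFin = (fun x : R => ((x - m)%:E + m%:E)%E).
  by apply/funext => x; rewrite -EFinD subrK.
apply: integrableD => //; last exact: finite_measure_integrable_cst.
have mB : measurable_fun setT (fun x : R => x - m) by exact: measurable_funB.
apply/integrableP; split; first exact/measurable_EFinP.
rewrite (ge0_integral_normal_prob _ _ _ (fun x => `|x - m|))//; last first.
  exact: measurableT_comp.
pose c := s * normal_peak s / normal_peak (Num.sqrt 2 * s).
apply: (@le_lt_trans _ _
    (\int[lebesgue_measure]_x (c * normal_pdf m (Num.sqrt 2 * s) x)%:E)%E).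
  apply: ge0_le_integral => //=.
  - by move=> x _; rewrite lee_fin mulr_ge0// normal_pdf_ge0.
  - apply/measurable_EFinP/measurable_funM; last exact: measurable_normal_pdf.
    exact: measurableT_comp.
  - apply/measurable_EFinP/measurable_funM => //.
    exact: measurable_normal_pdf.
  - by move=> x _; rewrite lee_fin; exact: normal_pdf_widen.
under eq_integral do rewrite EFinM.
rewrite integralZl ?integral_normal_pdf ?mule1 ?ltry//.
exact: integrable_normal_pdf.
Qed.

Lemma normal_pdf_reflect (R : realType) (m s x : R) : s != 0 ->
  normal_pdf m s (m *+ 2 - x) = normal_pdf m s x.
Proof.
move=> s0; rewrite (normal_pdfE m s0).
congr (_ * expR _); congr (- _ / _).
by rewrite mulr2n; ring.
Qed.

Lemma normal_prob_reflect (R : realType) (m s : R) (A : set R) : s != 0 ->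
  measurable A ->
  pushforward (normal_prob m s)
    ((fun x => m *+ 2 - x) : _ -> measurableTypeR R) A =
  normal_prob m s A.
Proof.
move=> s0 mA.
pose r : measurableTypeR R -> measurableTypeR R := fun x => m *+ 2 - x.
have mr : measurable_fun setT r by exact: measurable_funB.
have mpdf : measurable_fun setT (EFin \o normal_pdf m s).
  by apply/measurable_EFinP; exact: measurable_normal_pdf.
transitivity
  (\int[pushforward lebesgue_measure r]_(x in A) (normal_pdf m s x)%:E)%E.
  rewrite ge0_integral_pushforward//; last 2 first.
  - exact: measurable_funTS.
  - by move=> x _; rewrite lee_fin normal_pdf_ge0.
  by apply: eq_integral => x _; rewrite /r /= normal_pdf_reflect.
apply: eq_measure_integral => //= B mB _.
rewrite /pushforward -[RHS](lebesgue_measureDr _ (m *+ 2))//.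
rewrite -[RHS]lebesgue_measureN /pushforward.
  by congr lebesgue_measure; apply/seteqP; split => x /=; rewrite addrC.
rewrite -[X in measurable X]setTI.
by apply: measurable_funD.
Qed.

(** The reflection about m preserves the distribution, so the mean e, which is
    finite, satisfies e = 2 m - e. *)
Lemma mean_normal_prob (R : realType) (m s : R) : 0 < s ->
  (\int[normal_prob m s]_x x%:E = m%:E)%E.
Proof.
move=> s0; have intid := integrable_normal_prob_id R m s s0.
have intr : (normal_prob m s).-integrable setT (fun x => (m *+ 2 - x)%:E).
  under eq_fun do rewrite EFinB.
  by apply: integrableB => //; exact: finite_measure_integrable_cst.
pose r : measurableTypeR R -> measurableTypeR R := fun x => m *+ 2 - x.
have mr : measurable_fun setT r by exact: measurable_funB.
have : (\int[normal_prob m s]_x x%:E =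
        \int[normal_prob m s]_x (m *+ 2 - x)%:E)%E.
  have := @integral_pushforward _ _ _ _ _ r mr (normal_prob m s) setT EFin.
  rewrite preimage_setT => <- //; apply: eq_measure_integral => //= A mA _.
  by rewrite -[LHS]normal_prob_reflect// gt_eqF.
under [in RHS]eq_integral do rewrite EFinB.
rewrite integralB//; last exact: finite_measure_integrable_cst.
have N1 : normal_prob m s setT = 1%E by exact: integral_normal_pdf.
rewrite integral_cst//= N1 mule1.
have : (\int[normal_prob m s]_x x%:E \is a fin_num)%E.
  exact: integrable_fin_num.
case: (\int[normal_prob m s]_x x%:E)%E => // e _ [ee].
by congr EFin; move: ee; rewrite mulr2n; lra.
Qed.

(** * Independence and conditioning on U *)

(** Independence says that the image by Y of P restricted to A is the law of Y
    scaled by P A; integrate f against both. *)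
Lemma ge0_integral_indep d (T : measurableType d) (R : realType)
    (P : probability T R) (Y : {RV P >-> R}) (A : set T) (f : R -> \bar R) :
  measurable A ->
  (forall B : set R, measurable B ->
    P (Y @^-1` B `&` A) = (P (Y @^-1` B) * P A)%E) ->
  measurable_fun setT f -> (forall y, 0 <= f y)%E ->
  (\int[P]_(w in A) f (Y w) = P A * \int[P]_w f (Y w))%E.
Proof.
move=> mA indA mf f0.
have mY : measurable_fun setT (Y : T -> R) by exact: measurable_funP.
have mfY : measurable_fun setT (f \o Y) by exact: measurableT_comp.
pose PA := mrestr P mA.
transitivity (\int[PA]_(w in A) f (Y w))%E.
  apply: eq_measure_integral => B mB BA.
  by rewrite /PA/= /mrestr (setIidl BA).
have -> : (\int[PA]_(w in A) f (Y w) = \int[PA]_w f (Y w))%E.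
  rewrite [RHS](@ge0_negligible_integral _ _ _ _ _ (~` A))//.
  - by rewrite setTD setCK.
  - exact: measurableC.
  - by rewrite /PA/= /mrestr setICl measure0.
rewrite -[LHS](@ge0_integral_pushforward _ _ _ _ _ _ mY PA setT f)//.
pose k := NngNum (fine_ge0 (measure_ge0 P A)).
transitivity (\int[mscale k (distribution P Y)]_y f y)%E.
  apply: eq_measure_integral => //= B mB _.
  rewrite /mscale/= fineK ?fin_num_measure//.
  by rewrite /distribution /pushforward /PA/= /mrestr indA// muleC.
rewrite ge0_integral_mscale//= fineK ?fin_num_measure//; congr (_ * _)%E.
by rewrite ge0_integral_pushforward.
Qed.

Lemma integral_indep d (T : measurableType d) (R : realType)
    (P : probability T R) (Y : {RV P >-> R}) (A : set T) (f : R -> R) :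
  measurable A ->
  (forall B : set R, measurable B ->
    P (Y @^-1` B `&` A) = (P (Y @^-1` B) * P A)%E) ->
  measurable_fun setT f -> P.-integrable setT (fun w => (f (Y w))%:E) ->
  (\int[P]_(w in A) (f (Y w))%:E = (\int[P]_w (f (Y w))%:E) * P A)%E.
Proof.
move=> mA indA mf fint; pose F := EFin \o f.
have mF : measurable_fun setT F by exact/measurable_EFinP.
have posE : (fun w => F (Y w))^\+%E = (fun w => (F^\+ (Y w))%E).
  exact: (funepos_comp F Y).
have negE : (fun w => F (Y w))^\-%E = (fun w => (F^\- (Y w))%E).
  exact: (funeneg_comp F Y).
rewrite integralE [in RHS]integralE posE negE.
have mp := measurable_funepos mF; have mn := measurable_funeneg mF.
rewrite (ge0_integral_indep _ _ _ _ _ A _ mA indA mp)//.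
rewrite (ge0_integral_indep _ _ _ _ _ A _ mA indA mn)//.
have pfin : (\int[P]_w F^\+ (Y w) \is a fin_num)%E.
  by rewrite -posE; apply: integrable_pos_fin_num.
have nfin : (\int[P]_w F^\- (Y w) \is a fin_num)%E.
  by rewrite -negE; apply: integrable_neg_fin_num.
rewrite muleBl ?fin_num_measure ?fin_num_adde_defl ?fin_numN//.
by congr (_ - _)%E; exact: muleC.
Qed.

Section sigma_gen.
Context d (T : measurableType d) (R : realType) (P : probability T R).
Variable U : {RV P >-> R}.

Lemma sigma_genE : <<s sigma_gen U>> = sigma_gen U.
Proof.
apply: sigma_algebra_id.
exact: sigma_algebra_preimage (sigma_algebra_measurable R).
Qed.

Lemma measurable_sigma_genP (A : set T) :
  (sigma_gen U).-sigma.-measurable A <->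
  exists2 B : set R, measurable B & U @^-1` B = A.
Proof.
rewrite /measurable/= sigma_genE; split => [[B mB <-]|[B mB <-]].
  by exists B; rewrite ?setTI.
by exists B; rewrite ?setTI.
Qed.

Lemma measurable_sigma_gen_sub (A : set T) :
  (sigma_gen U).-sigma.-measurable A -> measurable A.
Proof.
move=> /measurable_sigma_genP[B mB <-].
by rewrite -[X in measurable X]setTI; exact: measurable_funP.
Qed.

Lemma measurable_fun_sigma_gen :
  measurable_fun (setT : set (g_sigma_algebraType (sigma_gen U))) U.
Proof.
move=> _ B mB; rewrite setTI.
by apply/measurable_sigma_genP; exists B.
Qed.

Lemma measurable_fun_sigma_gen_sub (Z : T -> R) :
  measurable_fun (setT : set (g_sigma_algebraType (sigma_gen U))) Z ->
  measurable_fun setT Z.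
Proof.
by move=> mZ _ B mB; apply: measurable_sigma_gen_sub; exact: mZ.
Qed.

(** A variable X uncorrelated with the events of sigma(U) has a constant c as
    conditional expectation given U, and integrals do not see the null set N
    on which a sigma(U)-measurable Z departs from c. *)
Lemma condexp_cst_ae (X Z : T -> R) (c : R) (N : set T) :
  measurable N -> P N = 0%E -> (forall w, ~ N w -> Z w = c) ->
  measurable_fun (setT : set (g_sigma_algebraType (sigma_gen U))) Z ->
  P.-integrable setT (EFin \o X) ->
  (forall A, (sigma_gen U).-sigma.-measurable A ->
    \int[P]_(w in A) (X w)%:E = c%:E * P A)%E ->
  is_condexp P (sigma_gen U) X Z.
Proof.
move=> mN N0 ZE mZ intX XA.
have mZT : measurable_fun setT (EFin \o Z).
  exact/measurable_EFinP/measurable_fun_sigma_gen_sub.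
have Zc A : measurable A -> ae_eq P A (EFin \o Z) (cst c%:E).
  move=> mA; exists N; split => // w /=; apply: contra_notP => Nw _.
  by rewrite ZE.
split => //.
  have mTN : measurable (setT `\` N) by exact: measurableD.
  apply/(negligible_integrable mN measurableT mZT N0).
  apply: (eq_integrable mTN (cst c%:E)).
    by move=> w /set_mem[_ Nw]; rewrite /= ZE.
  exact: finite_measure_integrable_cst.
move=> A FA; have mA := measurable_sigma_gen_sub _ FA.
rewrite XA// (ae_eq_integral (cst c%:E))//.
- by rewrite integral_cst.
- exact: measurable_funTS.
- exact: Zc.
Qed.

End sigma_gen.

(** * Formulas modified on the event U = x *)

(** The values lie in an arbitrary type V so that formulas for conditional
    expectations and kernels, whose values are probability measures, are
    instances of the same construction. *)
Definition pinned (T V : Type) (R : realType) (U : T -> R) (a : R -> V) (c : V)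
  (x : R) (w : T) : V := if U w == x then a x else c.
Arguments pinned {T V R} U a c x w.

Section pinned.
Context d (T : measurableType d) (R : realType) (P : probability T R).
Variable U : {RV P >-> R}.
Let F := sigma_gen U.

Lemma measurable_pinned d' (V : measurableType d') (a : R -> V) (c : V) :
  measurable_fun setT a ->
  measurable_fun setT
    (fun wx : g_sigma_algebraType F * R => pinned U a c wx.2 wx.1).
Proof.
move=> ma; apply: measurable_fun_ifT => //=; last exact: measurableT_comp.
apply: measurable_fun_eqr => //.
by apply: measurableT_comp => //; exact: measurable_fun_sigma_gen.
Qed.

Lemma measurable_pinned_at d' (V : measurableType d') (a : R -> V) (c : V)
    (x : R) :
  measurable_fun (setT : set (g_sigma_algebraType F)) (pinned U a c x).
Proof.
apply: measurable_fun_ifT => //=.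
apply: measurable_fun_eqr => //; exact: measurable_fun_sigma_gen.
Qed.

Lemma jointly_measurable_pinned (a : R -> R) (c : R) : measurable_fun setT a ->
  jointly_measurable (pinned U a c : R -> g_sigma_algebraType F -> R).
Proof.
move=> ma; rewrite /jointly_measurable.
by apply: measurable_funTS; exact: measurable_pinned.
Qed.

End pinned.

(** A random index of a plug-in has to lie in [0, 1] everywhere, whereas a
    uniform variable does so only almost surely; the retraction onto [0, 1]
    repairs this. *)
Definition clamp (R : realType) (x : R) : R := Num.max 0 (Num.min 1 x).

Lemma measurable_clamp (R : realType) : measurable_fun setT (clamp R).
Proof.
by apply: measurable_maxr => //; exact: measurable_minr.
Qed.

Lemma clamp_unit (R : realType) (x : R) : clamp R x \in `[0, 1].
Proof. by rewrite in_itv/= /clamp le_max lexx ge_max ler01 ge_min lexx. Qed.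

Lemma clamp_id (R : realType) (x : R) : x \in `[0, 1] -> clamp R x = x.
Proof.
by rewrite in_itv/= /clamp => /andP[x0 x1]; rewrite (min_idPr x1) (max_idPr x0).
Qed.

Section normal_uniform_pair.
Context (R : realType) (m s : R) (s_gt0 : 0 < s).
Context d (T : measurableType d) (P : probability T R) (Y U : {RV P >-> R}).
Hypothesis YU : normal_uniform_pair m s Y U.
Let F := sigma_gen U.

Let mY : measurable_fun setT (Y : T -> R). Proof. exact: measurable_funP. Qed.

Lemma measurable_preim (X : {RV P >-> R}) (B : set R) :
  measurable B -> measurable (X @^-1` B).
Proof.
by move=> mB; rewrite -[X in measurable X]setTI; exact: measurable_funP.
Qed.

Lemma pair_atomless (x : R) : P (U @^-1` [set x]) = 0%E.
Proof.
have [_ lawU _] := YU; rewrite -[LHS]/(distribution P U [set x]) lawU//.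
have /null_content_dominatesP := @dominates_uniform_prob R 0 1 ltr01.
by apply; [exact: measurable_set1|exact: lebesgue_measure_set1].
Qed.

Lemma pair_indep (A B : set R) : measurable A -> measurable B ->
  P (Y @^-1` B `&` U @^-1` A) = (P (Y @^-1` B) * P (U @^-1` A))%E.
Proof. by have [_ _ ind] := YU => mA mB; exact: ind. Qed.

Lemma integrable_pair_fst : P.-integrable setT (EFin \o Y).
Proof.
have [lawY _ _] := YU.
have /integrableP[_ fin] := integrable_normal_prob_id R m s s_gt0.
apply/integrableP; split; first exact/measurable_EFinP.
apply: le_lt_trans fin; rewrite le_eqVlt; apply/orP; left; apply/eqP.
have := @ge0_integral_pushforward _ _ _ (measurableTypeR R) _ Y mY P setT
  (fun y => `|y%:E|)%E.
rewrite preimage_setT => <- //.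
- by apply: eq_measure_integral => //= B mB _; exact: lawY.
- by apply: measurableT_comp.
Qed.

Lemma expectation_pair_fst : ('E_P[Y] = m%:E)%E.
Proof.
have [lawY _ _] := YU.
rewrite unlock -(mean_normal_prob R m s s_gt0).
have := @integral_pushforward _ _ _ (measurableTypeR R) _ Y mY P setT EFin.
rewrite preimage_setT => <- //.
- by apply: eq_measure_integral => //= B mB _; exact: lawY.
- exact: integrable_pair_fst.
Qed.

(** Conditional expectations and conditional laws at once: f is the identity
    for the former and the indicator of a Borel set for the latter. *)
Lemma condexp_pinned (f : R -> R) (a : R -> R) (x : R) :
  measurable_fun setT f -> P.-integrable setT (fun w => (f (Y w))%:E) ->
  is_condexp P F (fun w => f (Y w))
    (pinned U a (fine (\int[P]_w (f (Y w))%:E)%E) x).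
Proof.
move=> mf intf; apply: (condexp_cst_ae _ _ _ _ _ _ _ _ (U @^-1` [set x])).
- exact: measurable_preim.
- exact: pair_atomless.
- by move=> w /eqP/negPf Uw; rewrite /pinned Uw.
- exact: measurable_pinned_at.
- exact: intf.
move=> A /measurable_sigma_genP[B mB <-].
rewrite (integral_indep _ _ _ _ _ (U @^-1` B) f)//.
- by rewrite fineK//; exact: integrable_fin_num.
- exact: measurable_preim.
- by move=> C mC; exact: pair_indep.
Qed.

Lemma condexp_pinned_fst (a : R -> R) (x : R) :
  is_condexp P F Y (pinned U a m x).
Proof.
have := condexp_pinned id a x.
have -> : (\int[P]_w (Y w)%:E)%E = m%:E.
  by have := expectation_pair_fst; rewrite unlock.
by apply => //; exact: integrable_pair_fst.
Qed.

Lemma condexp_mean : is_condexp P F Y (cst m).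
Proof.
(* pinning to the mean itself changes nothing *)
have := condexp_pinned_fst (cst m) 0; rewrite (_ : pinned _ _ _ _ = cst m)//.
by apply/funext => w; rewrite /pinned; case: ifP.
Qed.

Lemma condexp_integral (X Z : T -> R) : is_condexp P F X Z ->
  (\int[P]_w (Z w)%:E = \int[P]_w (X w)%:E)%E.
Proof. by case=> _ _ _ ; apply; exact: measurableT. Qed.

Lemma condexp_cst_neq (Z : T -> R) (b : R) : b != m -> (forall w, Z w = b) ->
  ~ is_condexp P F Y Z.
Proof.
move=> bm Zb /condexp_integral; under eq_integral do rewrite Zb.
rewrite integral_cst//= probability_setT mule1.
have := expectation_pair_fst; rewrite unlock => -> [/eqP].
by rewrite (negPf bm).
Qed.

Definition pinned_kernel_fun (wx : g_sigma_algebraType F * R) :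
    pprobability R R :=
  pinned U (cst (\d_(0 : R) : pprobability R R))
    (distribution P Y : pprobability R R) wx.2 wx.1.

Lemma measurable_pinned_kernel_fun : measurable_fun setT pinned_kernel_fun.
Proof. by apply: measurable_pinned. Qed.

Definition pinned_kernel : R.-pker (g_sigma_algebraType F * R) ~> R :=
  kprobability measurable_pinned_kernel_fun.

Lemma pinned_kernelE (x : R) (w : T) (B : set R) :
  fine (pinned_kernel (w, x) B) =
  pinned U (cst (\1_B 0)) (fine (P (Y @^-1` B))) x w.
Proof.
rewrite /pinned_kernel /= /kprobability /pinned_kernel_fun /pinned /=.
by case: ifP.
Qed.

Lemma integral_preim_law (B : set R) : measurable B ->
  (\int[P]_w (\1_B (Y w))%:E = P (Y @^-1` B))%E.
Proof.
move=> mB; rewrite (@integral_indic _ _ _ P _ measurableT (Y @^-1` B)) ?setIT//.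
exact: measurable_preim.
Qed.

Lemma pinned_kernel_joint : is_joint_kernel P (const_field Y) pinned_kernel.
Proof.
move=> x _ B mB.
have := condexp_pinned \1_B (cst (\1_B 0)) x.
rewrite integral_preim_law//.
rewrite (_ : pinned _ _ _ _ =
    fun w => fine (pinned_kernel (w, x) B)); last first.
  by apply/funext => w; rewrite pinned_kernelE.
apply; first exact: measurable_indic.
exact: (integrable_indic P (measurable_preim Y B mB)).
Qed.

Lemma pinned_kernel_barycentre (x : R) (w : T) :
  (\int[pinned_kernel (w, x)]_y y%:E = (punctured_mean Y U x w)%:E)%E.
Proof.
rewrite /pinned_kernel /= /kprobability /pinned_kernel_fun /pinned.
rewrite /punctured_mean /=.
rewrite expectation_pair_fst /= indicE.
case: ifPn => /eqP Ux.
  rewrite memNset ?mulr0; last by move=> /= /(_ Ux).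
  by rewrite integral_dirac// diracT mul1e.
rewrite mem_set ?mulr1// -expectation_pair_fst unlock.
by rewrite integral_pushforward ?preimage_setT//; exact: integrable_pair_fst.
Qed.

Lemma pair_unit : P (U @^-1` `[0, 1]) = 1%E.
Proof.
have [_ lawU _] := YU.
by rewrite -[LHS]/(distribution P U _) lawU//; exact: integral_uniform_pdf1.
Qed.

(** Stated for any index X that agrees with U when U lies in [0, 1], so as to
    cover both U itself and its retraction onto [0, 1].  The test event is
    U in [0, 1], and the test set is the singleton of 0: on that event the
    kernel gives it mass one, whereas Y has a density. *)
Lemma pinned_kernel_not_condlaw (X : T -> R) :
  (forall w, U w \in `[0, 1] -> X w = U w) ->
  ~ is_condlaw P F (fun w => const_field Y (X w) w)
      (fun w => pinned_kernel (w, X w)).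
Proof.
move=> XU /(_ [set 0] (measurable_set1 0)) [_ _ _].
have FA : F.-sigma.-measurable (U @^-1` `[0, 1]).
  by apply/measurable_sigma_genP; exists `[0, 1]%classic.
move=> /(_ _ FA).
have mA := measurable_sigma_gen_sub _ _ _ _ _ _ FA.
rewrite [LHS](eq_integral (cst 1%E)); last first.
  move=> w /set_mem Uw; rewrite pinned_kernelE /pinned XU// eqxx /=.
  by rewrite indicE mem_set.
have -> : (\int[P]_(w in U @^-1` `[0%R, 1%R]) cst 1 w = 1)%E.
  by rewrite integral_cst// mul1e; exact: pair_unit.
rewrite integral_indic// => P1; have /eqP : (1 = 0 :> \bar R)%E; last first.
  by rewrite onee_eq0.
apply: etrans P1 _.
apply: (@subset_measure0 _ _ _ _ _ (Y @^-1` [set 0])).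
- by apply: measurableI.
- exact: (measurable_preim Y _ (measurable_set1 0)).
- exact: subIsetl.
have [lawY _ _] := YU; rewrite -[LHS]/(distribution P Y [set 0]) lawY//.
have /null_content_dominatesP := @normal_prob_dominates R m s.
by apply; [exact: measurable_set1|exact: lebesgue_measure_set1].
Qed.

Lemma pinned_kernel_not_plug_in :
  ~ plug_in_consistent P (const_field Y) pinned_kernel.
Proof.
move=> /(_ (clamp R \o U)); apply/not_implyP; split.
  apply: (measurableT_comp (measurable_clamp R)).
  exact: measurable_fun_sigma_gen.
apply/not_implyP; split; first by move=> w; exact: clamp_unit.
by apply: pinned_kernel_not_condlaw => w; exact: clamp_id.
Qed.

End normal_uniform_pair.

(** * A model, and a formula that is not measurable along U *)

Lemma jointly_measurable_plug_in d (T : measurableType d) (R : realType)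
    (g : R -> T -> R) (X : T -> R) : jointly_measurable g ->
  measurable_fun setT X -> (forall w, X w \in `[0, 1]) ->
  measurable_fun setT (fun w => g (X w) w).
Proof.
move=> mg mX X01.
have mp : measurable_fun setT (fun w => (w, X w)) by exact: measurable_fun_pair.
apply: (measurable_comp _ _ mg mp).
- by apply: measurableX => //; exact: measurable_itv.
- by move=> _ [w _ <-]; split => //; exact: X01.
Qed.

Section model.
Context (R : realType) (m s : R).

Local Notation Omega := (measurableTypeR R * measurableTypeR R)%type.

Definition model_prob : probability Omega R :=
  (normal_prob m s \x uniform_prob (@ltr01 R))%E.

Let mY : measurable_fun setT (fst : Omega -> R).
Proof. exact: measurable_fst. Qed.

Let mU : measurable_fun setT (clamp R \o snd : Omega -> R).
Proof. exact: (measurableT_comp (measurable_clamp R) measurable_snd). Qed.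

Definition model_Y : {RV model_prob >-> R} :=
  MeasurableFun.Pack (MeasurableFun.Class (isMeasurableFun.Build _ _ _ _ _ mY)).

Definition model_U : {RV model_prob >-> R} :=
  MeasurableFun.Pack (MeasurableFun.Class (isMeasurableFun.Build _ _ _ _ _ mU)).

Lemma uniform_prob_clamp (B : set R) : measurable B ->
  uniform_prob (@ltr01 R) (clamp R @^-1` B) = uniform_prob (@ltr01 R) B.
Proof.
move=> mB; rewrite /uniform_prob integral_uniform_pdf [RHS]integral_uniform_pdf.
by congr integral; apply/seteqP; split => x [/= + x01]; rewrite clamp_id.
Qed.

Lemma model_pair : normal_uniform_pair m s model_Y model_U.
Proof.
have mC (B : set R) : measurable B -> measurable (clamp R @^-1` B).
  by move=> mB; rewrite -[X in measurable X]setTI; exact: measurable_clamp.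
have PE (A B : set R) : measurable A -> measurable B ->
    model_prob (model_Y @^-1` A `&` model_U @^-1` B) =
    (normal_prob m s A * uniform_prob (@ltr01 R) B)%E.
  move=> mA mB; rewrite -uniform_prob_clamp//.
  by rewrite -[RHS]product_measure1E//; last exact: mC.
split.
- move=> B mB; have := PE B setT mB measurableT.
  rewrite preimage_setT setIT /distribution /pushforward => ->.
  by rewrite (probability_setT (uniform_prob ltr01)) mule1.
- move=> B mB; have := PE setT B measurableT mB.
  rewrite preimage_setT setTI /distribution /pushforward => ->.
  by rewrite (probability_setT (normal_prob m s)) mul1e.
move=> A B mA mB; rewrite PE//.
have := PE A setT mA measurableT; rewrite preimage_setT setIT => ->.
have := PE setT B measurableT mB; rewrite preimage_setT setTI => ->.
rewrite (probability_setT (uniform_prob ltr01)) mule1.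
by rewrite (probability_setT (normal_prob m s)) mul1e.
Qed.

(** Were the composite measurable, then freezing the first coordinate would
    exhibit V as the trace on [0, 1] of a Borel set. *)
Lemma model_not_measurable (V : set R) : V `<=` `[0, 1] -> ~ measurable V ->
  ~ measurable_fun setT ((fun w => \1_V (model_U w)) : Omega -> R).
Proof.
move=> V01 nmV mV; apply: nmV.
have mV0 : measurable_fun setT
    (fun y : measurableTypeR R => \1_V (clamp R y) : R).
  exact: (measurableT_comp mV (pair1_measurable (0 : measurableTypeR R))).
have -> : V = `[0, 1] `&` ((fun y => \1_V (clamp R y) : R) @^-1` [set 1]).
  apply/seteqP; split => x /=.
    move=> Vx; have x01 := V01 _ Vx.
    by split; rewrite // clamp_id// indicE mem_set.
  move=> [x01]; rewrite clamp_id// indicE; case: (boolP (x \in V)).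
    by move=> /set_mem.
  by move=> _ /eqP; rewrite eq_sym oner_eq0.
apply: measurableI; first exact: measurable_itv.
by rewrite -[X in measurable X]setTI; exact: mV0.
Qed.

End model.

Theorem mainTheorem3 (R : realType) (m s : R) (s_gt0 : 0 < s) :
  (forall (d : measure_display) (T : measurableType d) (P : probability T R)
      (Y U : {RV P >-> R}),
    normal_uniform_pair m s Y U ->
    let F := sigma_gen U in
    let f := const_field Y in
    let g := punctured_mean Y U in
    (* g is a jointly measurable formula for E[f(x) | U], valid for all x *)
    ((jointly_measurable (g : R -> g_sigma_algebraType F -> R) /\
      forall x : R, x \in `[0, 1] -> is_condexp P F (f x) (g x)) /\
    (* U is F-measurable, g(U) = 0, E[f(U) | U] = E[Y] = m a.s. *)
     [/\ measurable_fun (setT : set (g_sigma_algebraType F)) U,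
         forall w, g (U w) w = 0,
         is_condexp P F (fun w => f (U w) w) (cst (fine ('E_P[Y])%E)) &
         ('E_P[Y])%E = m%:E]) /\
    (* for a non-zero mean, g is not valid at X = U *)
    (m != 0 ->
      (0 != 'E_P[Y])%E /\
      ~ is_condexp P F (fun w => f (U w) w) (fun w => g (U w) w)) /\
    (* whatever the mean, some jointly measurable formula is valid for all x *)
    (* but not at X = U *)
    (exists h : R -> T -> R,
      [/\ jointly_measurable (h : R -> g_sigma_algebraType F -> R),
          forall x : R, x \in `[0, 1] -> is_condexp P F (f x) (h x) &
          ~ is_condexp P F (fun w => f (U w) w) (fun w => h (U w) w)]) /\
    (* whatever the mean, some joint kernel with barycentre g is not *)
    (* plug-in consistent, and fails at X = U *)
    (exists kappa : R.-pker (g_sigma_algebraType F * R) ~> R,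
      [/\ is_joint_kernel P f kappa,
          forall (x : R) (w : T),
            (\int[kappa (w, x)]_y y%:E = (g x w)%:E)%E,
          ~ is_condlaw P F (fun w => f (U w) w) (fun w => kappa (w, U w)) &
          ~ plug_in_consistent P f kappa])) /\
  (* such pairs exist, and one admits a formula valid for all x that is not *)
  (* jointly measurable and for which g(U) is not a random variable *)
  (exists (d : measure_display) (T : measurableType d) (P : probability T R)
      (Y U : {RV P >-> R}),
    [/\ normal_uniform_pair m s Y U,
        forall w, U w \in `[0, 1] &
        exists g : R -> T -> R,
          [/\ forall x : R, x \in `[0, 1] ->
                is_condexp P (sigma_gen U) (const_field Y x) (g x),
              ~ jointly_measurable g &
              ~ measurable_fun setT (fun w => g (U w) w)]]).
Proof.
split.
  move=> d T P Y U YU F f g.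
  have EY := expectation_pair_fst R m s s_gt0 d T P Y U YU.
  have gE : g = pinned U (cst 0) m.
    apply/funext => x; apply/funext => w.
    rewrite /g /punctured_mean EY /pinned /= indicE; case: ifPn => /eqP Ux.
      by rewrite memNset ?mulr0//= => /(_ Ux).
    by rewrite mem_set ?mulr1.
  split; last split; last split.
  - split.
      split; first by rewrite gE; exact: jointly_measurable_pinned.
      by move=> x _; rewrite gE; exact: (condexp_pinned_fst R m s s_gt0).
    split => //.
    + exact: measurable_fun_sigma_gen.
    + by move=> w; rewrite gE /pinned eqxx.
    + by rewrite EY; exact: (condexp_mean R m s s_gt0).
  - move=> m0; split; first by rewrite EY eqe eq_sym.
    apply: (condexp_cst_neq R m s s_gt0 _ _ _ _ _ YU _ 0).
      by rewrite eq_sym.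
    by move=> w; rewrite gE /pinned eqxx.
  - exists (pinned U (cst (m + 1)) m); split.
    + exact: jointly_measurable_pinned.
    + by move=> x _; exact: (condexp_pinned_fst R m s s_gt0).
    + apply: (condexp_cst_neq R m s s_gt0 _ _ _ _ _ YU _ (m + 1)).
        by rewrite -subr_eq0 addrAC subrr add0r oner_eq0.
      by move=> w; rewrite /pinned eqxx.
  - exists (pinned_kernel R d T P Y U); split.
    + exact: (pinned_kernel_joint R m s).
    + exact: (pinned_kernel_barycentre R m s s_gt0).
    + by apply: (pinned_kernel_not_condlaw R m s d T P Y U YU U).
    + exact: (pinned_kernel_not_plug_in R m s d T P Y U YU).
have [V [V01 nmV]] := nonmeasurable_subset_unit_interval R.
exists _, _, (model_prob R m s), (model_Y R m s), (model_U R m s).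
have U01 w : model_U R m s w \in `[0, 1] by exact: clamp_unit.
have YU := model_pair R m s.
split => //.
pose g := pinned (model_U R m s) \1_V m.
have ng : ~ measurable_fun setT (fun w => g (model_U R m s w) w).
  have -> : (fun w => g (model_U R m s w) w) = fun w => \1_V (model_U R m s w).
    by apply/funext => w; rewrite /g /pinned eqxx.
  exact: model_not_measurable.
exists g; split => //.
  by move=> x _; exact: (condexp_pinned_fst R m s s_gt0).
by move=> jg; apply: ng; exact: jointly_measurable_plug_in.
Qed.
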